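(* Let $F$ be a locally compact complete non-Archimedean field of characteristic zero with nontrivial valuation. Let $L$ be a finite unramified extension of $F$ with $L^{g}=F$ for some $g\in\mathrm{Gal}(L/F)$ and let $C(X,\tau,g)$ be a basic ${}^{L}/_{F}$ function algebra. Then there is an isometric isomorphism $$\mathcal{O}(X,\tau,g)/\mathcal{J}(X,\tau,g)\cong C(X,\tau,\bar{g}),$$ where $C(X,\tau,\bar{g})$ is the basic ${}^{\overline{L}}/_{\overline{F}}$ function algebra on $(X,\tau,\bar{g})$; here $\overline{F}$ and $\overline{L}$ are respectively the residue fields of $F$ and $L$ and $\bar{g}$ is the residue automorphism on $\overline{L}$ induced by $g$. More generally, if $L$ is a finite, not necessarily unramified, extension of $F$ with $L^{g}=F$ for some $g\in\mathrm{Gal}(L/F)$ and $C(X,\tau,g)$ is a basic ${}^{L}/_{F}$ function algebra, then there is still an isometric isomorphism $\mathcal{O}(X,\tau,g)/\mathcal{J}(X,\tau,g)\cong C(X,\tau,\bar{g})$, with $C(X,\tau,\bar{g})$ the basic ${}^{\overline{L}}/_{\overline{F}}$ function algebra on $(X,\tau,\bar{g})$, provided that the condition $\mathrm{ord}(\tau)\mid\mathrm{ord}(\bar{g})$ is imposed directly.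
   Context: A valuation on a field $F$ is a multiplicative norm $|\cdot|_{F}:F\to\mathbb{R}$; $F$ with a valuation is a valued field, complete if complete in the induced metric, non-Archimedean if $|a-b|_F\le\max(|a|_F,|b|_F)$ for all $a,b\in F$. The valuation is trivial if it takes only the values $0,1$. A finite extension $L$ of $F$ carries the (unique, complete) extension of the valuation of $F$. $L$ is unramified over $F$ if $|L^\times|_L=|F^\times|_F$ (ramification index $1$). $\mathrm{Gal}(L/F)$ is the group of automorphisms of $L$ fixing $F$ pointwise; $L^{g}:=\{x\in L:g(x)=x\}$; $\mathrm{ord}(h)$ is the least $n\ge 1$ with $h^{(n)}=\mathrm{id}$ ($n$-fold composite). For a non-Archimedean field $K$: $\mathcal{O}_K=\{a:|a|_K\le1\}$, $\mathcal{M}_K=\{a:|a|_K<1\}$, and the residue field is $\overline{K}=\mathcal{O}_K/\mathcal{M}_K$. The residue fields $\overline{F}\subseteq\overline{L}$ carry the trivial valuation. For $g\in\mathrm{Gal}(L/F)$ (which is isometric), $\bar{g}\in\mathrm{Gal}(\overline{L}/\overline{F})$ is defined by $\bar{g}(\bar{a}):=\overline{g(a)}$, $a\in\mathcal{O}_L$. Basic function algebra: let $F,L$ be complete valued fields with $L$ a finite extension of $F$ as a valued field, $X$ a nonempty compact Hausdorff space, totally disconnected if $F$ is non-Archimedean, $g\in\mathrm{Gal}(L/F)$, and $\tau:X\to X$ continuous of finite order with $\mathrm{ord}(\tau)\mid\mathrm{ord}(g)$. With $C_L(X)$ the continuous $L$-valued functions on $X$ with pointwise operations and sup norm $\|\cdot\|_\infty$,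 the basic ${}^{L}/_{L^{g}}$ function algebra on $(X,\tau,g)$ is $C(X,\tau,g):=\{f\in C_L(X): f(\tau(x))=g(f(x))\ \forall x\in X\}$. Further $\mathcal{O}(X,\tau,g):=\{f\in C(X,\tau,g):\|f\|_\infty\le1\}$ (a ring) and $\mathcal{J}(X,\tau,g):=\{f\in C(X,\tau,g):\|f\|_\infty<1\}$ (an ideal of it). The quotient carries the usual quotient ring operations and the quotient norm $\inf\{\|f+h\|_\infty:h\in\mathcal{J}(X,\tau,g)\}$; $C(X,\tau,\bar g)$ carries the sup norm. *)

(* Defs.v *)
From HB Require Import structures.
From mathcomp Require Import all_boot all_order all_algebra all_field.
From mathcomp Require Import all_classical all_reals ereal topology.

Set Implicit Arguments.
Unset Strict Implicit.
Unset Printing Implicit Defensive.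

Import Order.TTheory GRing.Theory Num.Theory.
Local Open Scope classical_set_scope.
Local Open Scope ring_scope.
Local Open Scope quotient_scope.

Record valuation (R : realType) (K : fieldType) := Valuation {
  valuation_fun :> K -> R;
  valuation_ge0 : forall x, 0 <= valuation_fun x;
  valuation_eq0 : forall x, valuation_fun x = 0 <-> x = 0;
  valuationM : forall x y,
    valuation_fun (x * y) = valuation_fun x * valuation_fun y;
  valuationD : forall x y,
    valuation_fun (x + y) <= valuation_fun x + valuation_fun y }.

Section ValuationTheory.
Variables (R : realType) (K : fieldType) (v : valuation R K).

Lemma valuation0 : v 0 = 0. Proof. exact/valuation_eq0. Qed.

Lemma valuation1 : v 1 = 1.
Proof.
have v1N0 : v 1 != 0 by apply/eqP => /valuation_eq0/eqP; rewrite oner_eq0.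
by apply: (mulfI v1N0); rewrite -valuationM !mulr1.
Qed.

Lemma valuationN x : v (- x) = v x.
Proof.
have vN1 : v (-1) = 1.
  apply/eqP; rewrite -(@eqrXn2 _ 2) ?ler01 ?valuation_ge0 //.
  by rewrite expr2 -valuationM mulrNN mulr1 valuation1 expr1n.
by rewrite -mulN1r valuationM vN1 mul1r.
Qed.

Lemma valuationB x y : v (x - y) = v (y - x).
Proof. by rewrite -valuationN opprB. Qed.

Lemma valuationV x : v x^-1 = (v x)^-1.
Proof.
have [->|xN0] := eqVneq x 0; first by rewrite invr0 valuation0 invr0.
have vxN0 : v x != 0 by apply/eqP => /valuation_eq0/eqP; apply/negP.
by apply: (mulfI vxN0); rewrite -valuationM !divff // valuation1.
Qed.

End ValuationTheory.

Definition nonarchimedean (R : realType) (K : fieldType) (v : valuation R K) :=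
  forall a b, v (a - b) <= Num.max (v a) (v b).

Definition nontrivial_valuation (R : realType) (K : fieldType)
    (v : valuation R K) :=
  exists a, v a != 0 /\ v a != 1.

Record na_valuation (R : realType) (K : fieldType) := NAValuation {
  na_valuation_val :> valuation R K;
  na_valuationB : nonarchimedean na_valuation_val }.

(* [valued v] is [K] with the topology (uniformity, metric) induced by [v]. *)
Definition valued (R : realType) (K : fieldType) (v : valuation R K) : Type :=
  K.

Section ValuedTopology.
Variables (R : realType) (K : fieldType) (v : valuation R K).

HB.instance Definition _ := GRing.Field.copy (valued v) K.
HB.instance Definition _ := isPointed.Build (valued v) (0 : K).

Definition vball (x : valued v) (e : R) : set (valued v) :=
  [set y | v (x - y) < e].

HB.instance Definition _ :=
  hasNbhs.Build (valued v) (nbhs_ball_ vball).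

Lemma vball_center x (e : R) : 0 < e -> vball x e x.
Proof. by move=> e0; rewrite /vball /= subrr valuation0. Qed.

Lemma vball_sym x y (e : R) : vball x e y -> vball y e x.
Proof. by rewrite /vball /= valuationB. Qed.

Lemma vball_triangle x y z (e1 e2 : R) :
  vball x e1 y -> vball y e2 z -> vball x (e1 + e2) z.
Proof.
rewrite /vball /= => xy yz; have -> : x - z = (x - y) + (y - z).
  by rewrite addrA subrK.
by apply: le_lt_trans (valuationD _ _ _) _; apply: ltrD.
Qed.

Lemma vball_nbhsE : nbhs_ball_ vball = nbhs_ (entourage_ vball).
Proof.
rewrite predeq2E => x A; split.
- move=> [e e0 sA]; exists [set xy | vball xy.1 e xy.2]; first by exists e.
  by move=> y /xsectionP; exact: sA.
- move=> [E [e e0 sE] sA]; exists e => // y xy; apply: sA.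
  by apply/xsectionP; exact: sE.
Qed.

HB.instance Definition _ := Nbhs_isPseudoMetric.Build R (valued v)
  vball_nbhsE vball_center vball_sym vball_triangle erefl.

End ValuedTopology.

Definition complete_valuation (R : realType) (K : fieldType)
    (v : valuation R K) :=
  forall G : set_system (valued v), ProperFilter G -> cauchy G -> cvg G.

Definition isometric (R : realType) (K1 K2 : fieldType)
    (v1 : valuation R K1) (v2 : valuation R K2) (phi : K1 -> K2) :=
  forall x, v2 (phi x) = v1 x.

(* In an extension [L] of [F], the field [F] is identified with its image under
   an embedding [i : {rmorphism F -> L}]. *)
Definition finite_extension (F L : fieldType) (i : F -> L) :=
  exists (n : nat) (b : 'I_n -> L),
    forall x, exists c : 'I_n -> F, x = \sum_j i (c j) * b j.

Definition unramified (R : realType) (F L : fieldType)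
    (v : valuation R F) (w : valuation R L) :=
  w @` [set x | x != 0] = v @` [set a | a != 0].

Definition in_Gal (F L : fieldType) (i : F -> L) (g : {rmorphism L -> L}) :=
  bijective g /\ forall a, g (i a) = i a.

Definition fixed_field (L : fieldType) (g : L -> L) : set L :=
  [set x | g x = x].

Definition is_ord (T : Type) (h : T -> T) (n : nat) :=
  [/\ (0 < n)%N, iter n h = id &
      forall m, (0 < m)%N -> iter m h = id -> (n <= m)%N].

Definition finite_order (T : Type) (h : T -> T) := exists n, is_ord h n.

(* The value is 0 when [h] has infinite order. *)
Definition ord (T : Type) (h : T -> T) : nat := xget 0%N [set n | is_ord h n].

Section ResidueField.
Variables (R : realType) (K : fieldType) (v : na_valuation R K).

Definition valuation_ring_pred : {pred K} := fun x => v x <= 1.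

Lemma valuation_ring_closed : subring_closed valuation_ring_pred.
Proof.
split=> [|x y|x y]; rewrite !unfold_in /valuation_ring_pred ?valuation1 //.
- move=> x1 y1; apply: le_trans (na_valuationB _ _ _) _.
  by rewrite ge_max x1.
- by move=> x1 y1; rewrite valuationM mulr_ile1 // valuation_ge0.
Qed.

HB.instance Definition _ :=
  GRing.isSubringClosed.Build K valuation_ring_pred valuation_ring_closed.

Record valuation_ring : predArgType :=
  ValuationRing { vring_val :> K; vring_valP : vring_val \in valuation_ring_pred }.

HB.instance Definition _ := [isSub for vring_val].
HB.instance Definition _ := [Choice of valuation_ring by <:].
HB.instance Definition _ :=
  [SubChoice_isSubComNzRing of valuation_ring by <:].

Lemma vring_le1 (a : valuation_ring) : v (val a) <= 1.
Proof. exact: vring_valP. Qed.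

Definition maximal_ideal : {pred valuation_ring} := fun x => v (val x) < 1.

Lemma maximal_ideal_closed : idealr_closed maximal_ideal.
Proof.
split; rewrite ?unfold_in /maximal_ideal /= ?valuation0 ?valuation1 ?ltr01 ?ltxx //.
move=> a x y; rewrite !unfold_in /maximal_ideal => x1 y1.
have -> : val (a * x + y) = val a * val x - - val y by rewrite opprK.
apply: le_lt_trans (na_valuationB _ _ _) _.
rewrite gt_max valuationN y1 andbT valuationM.
by apply: le_lt_trans x1; rewrite ler_piMl ?valuation_ge0 // vring_le1.
Qed.

HB.instance Definition _ :=
  isIdealr.Build valuation_ring maximal_ideal maximal_ideal_closed.

Definition residue_field : Type := {ideal_quot maximal_ideal}.

HB.instance Definition _ := GRing.ComNzRing.on residue_field.

Definition residue (a : valuation_ring) : residue_field :=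
  \pi_{ideal_quot maximal_ideal} a.

Lemma residue_eq a b : residue a = residue b <-> v (val a - val b) < 1.
Proof.
rewrite -[_ < 1]/(a - b \in maximal_ideal) Quotient.idealrBE.
by split=> [/eqP|] // /eqP.
Qed.

Lemma residue_is_zmod : zmod_morphism residue. Proof. exact: rmorphB. Qed.
Lemma residue_is_monoid : monoid_morphism residue.
Proof. by split; [exact: rmorph1 | exact: rmorphM]. Qed.
HB.instance Definition _ :=
  GRing.isZmodMorphism.Build valuation_ring residue_field residue residue_is_zmod.
HB.instance Definition _ :=
  GRing.isMonoidMorphism.Build valuation_ring residue_field residue
    residue_is_monoid.

Lemma residue_reprK (q : residue_field) : residue (repr q) = q.
Proof. exact: reprK. Qed.

(* When [repr q] lies in the maximal ideal its inverse is either 0 or not in the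
   valuation ring, so that [insubd] returns 0. *)
Definition residue_inv (q : residue_field) : residue_field :=
  residue (insubd (0 : valuation_ring) (val (repr q : valuation_ring))^-1).

Lemma residue_mulVf q : q != 0 -> residue_inv q * q = 1.
Proof.
rewrite -{1 3}[q]residue_reprK /residue_inv.
set a := repr q => aN0.
have va1 : v (val a) = 1.
  apply/eqP; rewrite eq_le vring_le1 /= leNgt; apply/negP => va1.
  move/negP: aN0; apply; apply/eqP; rewrite -(rmorph0 residue).
  by apply/residue_eq; rewrite subr0.
have aVP : (val a)^-1 \in valuation_ring_pred.
  by rewrite unfold_in /valuation_ring_pred valuationV va1 invr1.
rewrite -rmorphM -(rmorph1 residue); congr residue; apply: val_inj.
rewrite rmorphM /= val_insubd aVP mulVf ?rmorph1 //.
by apply/eqP => /(valuation_eq0 v)/eqP; rewrite va1 oner_eq0.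
Qed.

Lemma residue_invr0 : residue_inv 0 = 0.
Proof.
rewrite /residue_inv; set a := repr _.
have va1 : v (val a) < 1.
  have : residue a = residue 0 by rewrite residue_reprK rmorph0.
  by move/residue_eq; rewrite subr0.
rewrite -(rmorph0 residue); congr residue; apply: val_inj.
rewrite val_insubd; case: ifPn => // aV1.
have [->|aN0] := eqVneq (val a) 0; first by rewrite invr0 rmorph0.
have va0 : 0 < v (val a).
  rewrite lt_def valuation_ge0 andbT; apply: contraNneq aN0.
  by move/(valuation_eq0 v) ->.
move: aV1; rewrite unfold_in /valuation_ring_pred valuationV invf_le1 //.
by rewrite leNgt va1.
Qed.

HB.instance Definition _ :=
  GRing.ComNzRing_isField.Build residue_field residue_mulVf residue_invr0.

End ResidueField.

Section ResidueMap.
Variables (R : realType) (K1 K2 : fieldType).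
Variables (v1 : na_valuation R K1) (v2 : na_valuation R K2).
Variables (phi : {rmorphism K1 -> K2}) (phi_isom : isometric v1 v2 phi).

Lemma vring_map_subproof (a : valuation_ring v1) :
  phi (val a) \in valuation_ring_pred v2.
Proof. by rewrite unfold_in /valuation_ring_pred phi_isom; exact: vring_valP. Qed.

Definition vring_map (a : valuation_ring v1) : valuation_ring v2 :=
  ValuationRing (vring_map_subproof a).

(* For [phi] an inclusion of valued fields this is the inclusion of residue
   fields, for [phi = g] a Galois automorphism it is its residue automorphism;
   see [residue_mapE]. *)
Definition residue_map (q : residue_field v1) : residue_field v2 :=
  residue (vring_map (repr q)).

Lemma residue_mapE a : residue_map (residue a) = residue (vring_map a).
Proof.
apply/residue_eq; rewrite /= -rmorphB phi_isom.
by apply/residue_eq; rewrite residue_reprK.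
Qed.

Lemma residue_map_is_zmod : zmod_morphism residue_map.
Proof.
move=> p q; rewrite -[p]residue_reprK -[q]residue_reprK -rmorphB !residue_mapE.
by rewrite -rmorphB; congr residue; apply: val_inj; rewrite /= !rmorphB.
Qed.

Lemma residue_map_is_monoid : monoid_morphism residue_map.
Proof.
split=> [|p q].
  rewrite -(rmorph1 (@residue _ _ v1)) residue_mapE -(rmorph1 (@residue _ _ v2)).
  by congr residue; apply: val_inj; rewrite /= !rmorph1.
rewrite -[p]residue_reprK -[q]residue_reprK -rmorphM !residue_mapE.
by rewrite -rmorphM; congr residue; apply: val_inj; rewrite /= !rmorphM.
Qed.

HB.instance Definition _ := GRing.isZmodMorphism.Build
  (residue_field v1) (residue_field v2) residue_map residue_map_is_zmod.
HB.instance Definition _ := GRing.isMonoidMorphism.Build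
  (residue_field v1) (residue_field v2) residue_map residue_map_is_monoid.

End ResidueMap.

Section TrivialValuation.
Variables (R : realType) (K : fieldType).

Definition trivial_fun (x : K) : R := (x != 0)%:R.

Lemma trivial_ge0 x : 0 <= trivial_fun x. Proof. exact: ler0n. Qed.

Lemma trivial_eq0 x : trivial_fun x = 0 <-> x = 0.
Proof.
rewrite /trivial_fun; have [->|xN0] := eqVneq x 0; split=> //.
- by move/eqP; rewrite oner_eq0.
- by move=> x0; rewrite x0 eqxx in xN0.
Qed.

Lemma trivialM x y : trivial_fun (x * y) = trivial_fun x * trivial_fun y.
Proof. by rewrite /trivial_fun mulf_eq0 negb_or -natrM mulnb. Qed.

Lemma trivialD x y : trivial_fun (x + y) <= trivial_fun x + trivial_fun y.
Proof.
rewrite /trivial_fun -natrD ler_nat.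
have [->|] := eqVneq x 0; first by rewrite add0r.
by move=> _; apply: leq_trans (leq_b1 _) _.
Qed.

Definition trivial_valuation : valuation R K :=
  Valuation trivial_ge0 trivial_eq0 trivialM trivialD.

End TrivialValuation.

Section FunctionAlgebra.
Variables (R : realType) (L : fieldType) (w : valuation R L).
Variables (X : ptopologicalType) (tau : X -> X) (g : {rmorphism L -> L}).

Definition fun_alg_pred : {pred X -> valued w} :=
  fun f => `[< continuous f /\ forall x, f (tau x) = g (f x) >].

Lemma continuous_valuedP (f : X -> valued w) : continuous f <->
  forall x (e : R), 0 < e -> \forall y \near x, w (f x - f y) < e.
Proof.
split=> [cf x e e0|cf x]; first by have /cvg_ballP/(_ e e0) := cf x.
by apply/cvg_ballP => e /(cf x).
Qed.

Lemma fun_alg_closed : subring_closed fun_alg_pred.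
Proof.
split=> [|f h|f h]; rewrite !unfold_in.
- apply/asboolP; split=> [|x]; last by rewrite [RHS]rmorph1.
  exact: cst_continuous.
- move=> /asboolP[/continuous_valuedP cf gf] /asboolP[/continuous_valuedP ch gh].
  apply/asboolP; split=> [|x]; last first.
    by rewrite /= [RHS]rmorphB; congr (_ - _); [exact: gf | exact: gh].
  apply/continuous_valuedP => x e e0.
  have e20 : 0 < e / 2 by rewrite divr_gt0.
  near=> y.
  have -> : (f - h) x - (f - h) y = (f x - f y) - (h x - h y) :> L.
    rewrite -[(f - h) x]/(f x - h x) -[(f - h) y]/(f y - h y).
    by rewrite !opprB addrACA [RHS]addrACA [- h x + _]addrC.
  apply: le_lt_trans (valuationD _ _ _) _; rewrite valuationN [ltRHS]splitr.
  by apply: ltrD; near: y; [exact: cf | exact: ch].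
- move=> /asboolP[/continuous_valuedP cf gf] /asboolP[/continuous_valuedP ch gh].
  apply/asboolP; split=> [|x]; last first.
    by rewrite /= [RHS]rmorphM; congr (_ * _); [exact: gf | exact: gh].
  apply/continuous_valuedP => x e e0.
  pose A := w (f x) + 1; pose B := w (h x) + 1.
  have A0 : 0 < A by rewrite ltr_wpDl ?valuation_ge0.
  have B0 : 0 < B by rewrite ltr_wpDl ?valuation_ge0.
  near=> y.
  have -> : (f * h) x - (f * h) y = f x * (h x - h y) + (f x - f y) * h y :> L.
    by rewrite mulrBr mulrBl addrA subrK.
  have hy : w (h y) <= B.
    have -> : h y = h x - (h x - h y) :> L by rewrite opprB addrC subrK.
    apply: le_trans (valuationD _ _ _) _; rewrite valuationN lerD2l.
    by apply: ltW; near: y; exact: ch.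
  apply: le_lt_trans (valuationD _ _ _) _; rewrite [ltRHS]splitr !valuationM.
  apply: ltrD.
  + apply: (@le_lt_trans _ _ (A * w (h x - h y))).
      by rewrite ler_wpM2r ?valuation_ge0 // lerDl.
    rewrite -ltr_pdivlMl //; near: y; apply: ch.
    by rewrite mulr_gt0 ?invr_gt0 // divr_gt0.
  + apply: (@le_lt_trans _ _ (w (f x - f y) * B)).
      by rewrite ler_wpM2l ?valuation_ge0.
    rewrite -ltr_pdivlMr //; near: y; apply: cf.
    by rewrite !divr_gt0.
Unshelve. all: by end_near. Qed.

HB.instance Definition _ :=
  GRing.isSubringClosed.Build (X -> valued w) fun_alg_pred fun_alg_closed.

Record fun_alg : predArgType :=
  FunAlg { fun_alg_val :> X -> valued w;
           fun_alg_valP : fun_alg_val \in fun_alg_pred }.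

HB.instance Definition _ := [isSub for fun_alg_val].
HB.instance Definition _ := [Choice of fun_alg by <:].
HB.instance Definition _ := [SubChoice_isSubComNzRing of fun_alg by <:].

(* Extended-real valued, so that no finiteness has to be known to form it; for
   compact [X] the values are finite. *)
Definition sup_norm (f : fun_alg) : \bar R :=
  ereal_sup [set (w (f x))%:E | x in [set: X]].

End FunctionAlgebra.

Section UnitBall.
Variables (R : realType) (L : fieldType) (w : na_valuation R L).
Variables (X : ptopologicalType) (tau : X -> X) (g : {rmorphism L -> L}).
Local Notation C := (fun_alg w tau g).

Lemma sup_normB (f h : C) :
  (sup_norm (f - h)%R <= Order.max (sup_norm f) (sup_norm h))%E.
Proof.
apply: ge_ereal_sup => _ [x _ <-].
apply: (@le_trans _ _ (Order.max (w (f x))%:E (w (h x))%:E)).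
  by rewrite -EFin_max lee_fin; exact: na_valuationB.
rewrite ge_max !le_max; apply/andP; split; apply/orP; [left|right];
  by apply: ereal_sup_ubound; exists x.
Qed.

Lemma sup_normM (f h : C) : (sup_norm f <= 1)%E ->
  (sup_norm (f * h)%R <= sup_norm h)%E.
Proof.
move=> f1; apply: ge_ereal_sup => _ [x _ <-].
apply: (@le_trans _ _ (w (h x))%:E); last by apply: ereal_sup_ubound; exists x.
have fx1 : w (f x) <= 1.
  by rewrite -lee_fin; apply: le_trans f1; apply: ereal_sup_ubound; exists x.
rewrite lee_fin.
have -> : (f * h) x = (f x : L) * h x by [].
by rewrite valuationM ler_piMl ?valuation_ge0.
Qed.

Lemma sup_norm1 : sup_norm (1 : C) = 1%E.
Proof.
apply/eqP; rewrite eq_le; apply/andP; split.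
  apply: ge_ereal_sup => _ [x _ <-].
  by have -> : (1 : C) x = (1 : L) by []; rewrite valuation1.
apply: ereal_sup_ubound; exists point => //.
by have -> : (1 : C) point = (1 : L) by []; rewrite valuation1.
Qed.

Lemma sup_norm0 : sup_norm (0 : C) = 0%E.
Proof.
apply/eqP; rewrite eq_le; apply/andP; split.
  apply: ge_ereal_sup => _ [x _ <-].
  by have -> : (0 : C) x = (0 : L) by []; rewrite valuation0.
apply: ereal_sup_ubound; exists point => //.
by have -> : (0 : C) point = (0 : L) by []; rewrite valuation0.
Qed.

Definition unit_ball_pred : {pred C} := fun f => (sup_norm f <= 1)%E.

Lemma unit_ball_closed : subring_closed unit_ball_pred.
Proof.
split=> [|f h|f h]; rewrite !unfold_in /unit_ball_pred ?sup_norm1 //.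
- by move=> f1 h1; apply: le_trans (sup_normB _ _) _; rewrite ge_max f1.
- by move=> f1 h1; apply: le_trans (sup_normM _ _) h1.
Qed.

HB.instance Definition _ :=
  GRing.isSubringClosed.Build C unit_ball_pred unit_ball_closed.

Record unit_ball : predArgType :=
  UnitBall { unit_ball_val :> C; unit_ball_valP : unit_ball_val \in unit_ball_pred }.

HB.instance Definition _ := [isSub for unit_ball_val].
HB.instance Definition _ := [Choice of unit_ball by <:].
HB.instance Definition _ := [SubChoice_isSubComNzRing of unit_ball by <:].

Definition open_unit_ball : {pred unit_ball} :=
  fun f => (sup_norm (val f) < 1)%E.

Lemma open_unit_ball_closed : idealr_closed open_unit_ball.
Proof.
split; rewrite ?unfold_in /open_unit_ball.
- by rewrite rmorph0 sup_norm0 lte_fin ltr01.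
- by rewrite rmorph1 sup_norm1 ltxx.
- move=> a f h; rewrite !unfold_in => f1 h1.
  have -> : val (a * f + h) = val a * val f - - val h by rewrite opprK.
  apply: le_lt_trans (sup_normB _ _) _; rewrite gt_max.
  rewrite (le_lt_trans (sup_normM _ _) f1) //=; last exact: unit_ball_valP.
  rewrite -[- _]sub0r; apply: le_lt_trans (sup_normB _ _) _.
  by rewrite gt_max sup_norm0 lte_fin ltr01.
Qed.

HB.instance Definition _ :=
  isIdealr.Build unit_ball open_unit_ball open_unit_ball_closed.

(* [unit_ball] is O(X, tau, g), [open_unit_ball] is J(X, tau, g) as an ideal of
   it, and [residue_algebra] is O(X, tau, g) / J(X, tau, g). *)
Definition residue_algebra : Type := {ideal_quot open_unit_ball}.

HB.instance Definition _ := GRing.ComNzRing.on residue_algebra.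

Definition quotient_norm (q : residue_algebra) : \bar R :=
  ereal_inf [set sup_norm (val (repr q + h : unit_ball))
            | h in [set h | h \in open_unit_ball]].

End UnitBall.

(* The data from which the basic L / L^g function algebra [fun_alg w tau g] is
   formed; nonemptiness of [X] is part of [ptopologicalType]. *)
Record basic_function_algebra (R : realType) (F L : fieldType)
    (v : valuation R F) (w : valuation R L) (i : F -> L)
    (X : ptopologicalType) (tau : X -> X) (g : {rmorphism L -> L}) : Prop :=
  BasicFunctionAlgebra {
    bfa_complete_base : complete_valuation v;
    bfa_complete_ext : complete_valuation w;
    bfa_finite : finite_extension i;
    bfa_extends : isometric v w i;
    bfa_compact : compact [set: X];
    bfa_hausdorff : hausdorff_space X;
    bfa_disconnected : nonarchimedean v -> totally_disconnected [set: X];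
    bfa_gal : in_Gal i g;
    bfa_continuous : continuous tau;
    bfa_finite_order : finite_order tau;
    bfa_ord : (ord tau %| ord g)%N }.

(* A basic L / F function algebra is a basic L / L^g one with L^g = F. *)
Definition basic_function_algebra_over (R : realType) (F L : fieldType)
    (v : valuation R F) (w : valuation R L) (i : F -> L)
    (X : ptopologicalType) (tau : X -> X) (g : {rmorphism L -> L}) :=
  basic_function_algebra v w i tau g /\ fixed_field g = range i.

Definition isometrically_isomorphic (R : realType) (A B : nzRingType)
    (nA : A -> \bar R) (nB : B -> \bar R) :=
  exists phi : {rmorphism A -> B}, bijective phi /\ forall a, nB (phi a) = nA a.

Arguments isometrically_isomorphic {R} A B nA nB.
Arguments sup_norm {R L w X tau g} f.
Arguments quotient_norm {R L w X tau g} q.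

(* Main.v *)
Require Import Defs.
From HB Require Import structures.
From mathcomp Require Import all_boot all_order all_algebra all_field.
From mathcomp Require Import all_classical all_reals ereal topology.
From mathcomp Require Import normedtype sequences.

Set Implicit Arguments.
Unset Strict Implicit.
Unset Printing Implicit Defensive.

Import Order.TTheory GRing.Theory Num.Theory numFieldNormedType.Exports.
Local Open Scope classical_set_scope.
Local Open Scope ring_scope.

(** The theorem rests on three facts about the extension L of F and on one
    canonical choice of representatives for the residue field of L.

    Isometry. Since F is locally compact, the coordinates of x in a basis of L
    over F are bounded by a multiple of the value of x ([coord_bounded]). Hence
    an F-automorphism g is bounded by a constant D; applied to all powers of x
    this forces the value of g x to be at most that of x, and applied to inverses
    it gives equality ([galois_isometric]).

    Finiteness. The same bound carries the total boundedness of the balls of F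
    to the unit ball of L. So the residue field of L is finite
    ([residue_field_finite]) and the values less than 1 are bounded by some
    r < 1 ([valuation_gap]). For q the order of the residue field, x^q = x and
    q = 0 hold there, and raising to the power q contracts distances inside a
    residue class by the factor r ([exp_contraction]).

    Teichmuller representatives. By this contraction and completeness each
    residue class contains exactly one t with t^q = t. Uniqueness makes this
    choice of t commute with every isometric automorphism
    ([equivariant_section]). Two things follow. A residue fixed by the residue
    automorphism of g has a representative fixed by g, which lies in F, so the
    residue algebra is again one over the residue field of F. And composing a
    locally constant residue-valued function with the section gives an
    equivariant lift, so reduction of functions is onto ([residue_fun_surj]).
    Its kernel is the open unit ball because X is compact ([open_unit_ballP]),
    and both norms only take the values 0 and 1 ([quotient_residue_fun_norm]).

    Orders. In the unramified case an automorphism h over F which is trivial on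
    residues is trivial: the bound on the values of h x - x for integral x
    improves by the factor r at each step ([inertia_trivial]). So g and its
    residue automorphism have the same order, and the divisibility imposed in
    the general case is inherited. *)

(** * Powers of real numbers *)

Section RealPowers.
Variable R : realType.

Lemma exists_expr_lt (r e : R) : 0 <= r < 1 -> 0 < e -> exists n, r ^+ n < e.
Proof.
move=> /andP[r0 r1] e0.
have /(@cvg_expr R)/cvgrPdist_lt/(_ e e0)[n _ /(_ n (leqnn n))] : `|r| < 1.
  by rewrite ger0_norm.
by rewrite /= sub0r normrN ger0_norm ?exprn_ge0 //; exists n.
Qed.

Lemma le1_expr_bounded (r C : R) : 0 <= r ->
  (forall n, r ^+ n <= C) -> r <= 1.
Proof.
move=> r0 rC; rewrite leNgt; apply/negP => r1.
have C0 : 0 < C by apply: lt_le_trans ltr01 _; exact: (rC 0).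
have [|| n] := @exists_expr_lt r^-1 C^-1.
- by rewrite invr_ge0 r0 invf_lt1 ?(lt_trans ltr01).
- by rewrite invr_gt0.
rewrite exprVn ltf_pV2 ?posrE ?C0 ?exprn_gt0 ?(lt_trans ltr01) //.
by rewrite ltNge rC.
Qed.

End RealPowers.

(** * Valuations *)

Section ValuationLemmas.
Variables (R : realType) (K : fieldType).

Lemma valuation_gt0 (v : valuation R K) x : x != 0 -> 0 < v x.
Proof.
move=> x0; rewrite lt_def valuation_ge0 andbT.
by apply: contraNneq x0 => /valuation_eq0 ->.
Qed.

Lemma valuationX (v : valuation R K) x n : v (x ^+ n) = v x ^+ n.
Proof.
by elim: n => [|n IHn]; rewrite ?expr0 ?valuation1 // !exprS valuationM IHn.
Qed.

Lemma nontrivial_small (v : valuation R K) (e : R) :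
  nontrivial_valuation v -> 0 < e -> exists2 t, t != 0 & v t < e.
Proof.
move=> [a [va0 va1]] e0.
have a0 : a != 0 by apply: contraNneq va0 => ->; rewrite valuation0.
wlog va_lt1 : a a0 va0 va1 / v a < 1 => [hwlog|].
  have [?|] := ltP (v a) 1; first exact: (hwlog a).
  rewrite le_eqVlt eq_sym (negPf va1) /= => va_gt1.
  apply: (hwlog a^-1); rewrite ?invr_eq0 ?valuationV ?invr_eq0 ?invr_eq1 //.
  by rewrite invf_lt1 // (lt_trans ltr01).
have [|n an] := @exists_expr_lt R (v a) e _ e0; first by rewrite valuation_ge0.
by exists (a ^+ n); rewrite ?expf_neq0 // valuationX.
Qed.

Variable v : na_valuation R K.

Lemma na_valuationD x y : v (x + y) <= Num.max (v x) (v y).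
Proof. by rewrite -{1}[y]opprK -[v y]valuationN; exact: na_valuationB. Qed.

Lemma na_valuation_sum_le (I : finType) (F : I -> K) (r : R) :
  0 <= r -> (forall i, v (F i) <= r) -> v (\sum_i F i) <= r.
Proof.
move=> r0 Fr; elim/big_ind : _ => [|x y xr yr|//]; first by rewrite valuation0.
by apply: le_trans (na_valuationD _ _) _; rewrite ge_max xr.
Qed.

(** The isosceles triangle principle. *)
Lemma na_valuation_eq x y : v (x - y) < v x -> v x = v y.
Proof.
move=> xy; apply/eqP; rewrite eq_le; apply/andP; split.
  rewrite leNgt; apply/negP => yx; have := na_valuationD (x - y) y.
  by rewrite subrK leNgt gt_max xy yx.
have := na_valuationB v x (x - y); rewrite opprB addrC subrK.
by move/le_trans; apply; rewrite ge_max lexx ltW.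
Qed.

End ValuationLemmas.

(** * Compactness *)

Section Compactness.
Variable R : realType.

(** Continuity of [phi] is replaced by a locally uniform lower bound, so that no
    minimum has to be attained. *)
Lemma compact_lower_bound (T : topologicalType) (A : set T) (phi : T -> R) :
    compact A ->
    (forall x, A x -> exists2 d, 0 < d & \forall y \near x, d <= phi y) ->
  exists2 d, 0 < d & forall x, A x -> d <= phi x.
Proof.
move=> /compact_near_coveringP cA phi_gt0.
have [n _ An] : \forall n \near \oo, A `<=` (fun x => n.+1%:R^-1 <= phi x).
  apply: cA => x /phi_gt0[d d0 dphi].
  exists ([set y | d <= phi y], [set n | n.+1%:R^-1 <= d]) => /=.
    split=> //; exists (Num.bound d^-1) => // n /= dn.
    rewrite invf_ple ?posrE //; apply: ltW.
    apply: lt_le_trans (archi_boundP _) _; first by rewrite invr_ge0 ltW.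
    by rewrite ler_nat ltnW.
  by move=> [y n] /= [dy nd]; exact: le_trans dy.
by exists n.+1%:R^-1; [rewrite invr_gt0|move=> x /(An n (leqnn n))].
Qed.

Lemma compact_finite_net (K : fieldType) (v : valuation R K)
    (A : set (valued v)) (e : R) : compact A -> 0 < e ->
  exists s : seq K, forall x, A x -> exists2 y, y \in s & v (x - y) < e.
Proof.
rewrite compact_cover => cA e0.
have [|x Ax|D _ AD] := cA _ setT (fun y : valued v => (ball y e)^°).
- by move=> y _; exact: open_interior.
- by exists x => //; exact: nbhsx_ballx.
exists (finmap.enum_fset D) => x /AD[y /= Dy /interior_subset xy].
by exists y => //; rewrite valuationB.
Qed.

Lemma loc_compact_ball (K : fieldType) (v : valuation R K) :
    locally_compact [set: valued v] ->
  exists2 A : set (valued v), compact A &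
    exists2 d, 0 < d & forall x, v x < d -> A x.
Proof.
move=> lcK; have [A wA [cA _]] := lcK 0 I; exists A => //.
have /nbhs_ballP[d /= d0 dA] : nbhs (0 : valued v) A.
  by move: wA; rewrite /within /=; apply: filterS => x; exact.
exists d => // x xd; apply: dA; change (v (0 - x) < d).
by rewrite sub0r valuationN.
Qed.

(** A ball of any radius is shrunk into the compact neighbourhood of 0 by a
    scalar [t] of small value. *)
Lemma loc_compact_finite_net (K : fieldType) (v : valuation R K) (r e : R) :
    locally_compact [set: valued v] -> nontrivial_valuation v -> 0 < e ->
  exists s : seq K, forall x, v x <= r -> exists2 y, y \in s & v (x - y) < e.
Proof.
move=> /loc_compact_ball[A cA [d d0 dA]] ntK e0.
have r1 : 0 < `|r| + 1 by rewrite ltr_wpDl.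
have [|t t0 td] := @nontrivial_small R K v (d / (`|r| + 1)) ntK.
  by rewrite divr_gt0.
have vt0 := valuation_gt0 v t0.
have [|s sP] := compact_finite_net (e := e * v t) cA; first by rewrite mulr_gt0.
exists [seq y / t | y <- s] => x xr.
have /sP[y ys yt] : A (t * x).
  apply: dA; rewrite valuationM.
  rewrite ltr_pdivlMr // in td; apply: le_lt_trans td.
  rewrite ler_wpM2l ?valuation_ge0 //; apply: le_trans xr _.
  by rewrite (le_trans (ler_norm r)) // lerDl.
exists (y / t); first exact: map_f.
rewrite -(ltr_pM2r vt0) -valuationM mulrBl mulfVK // [x * t]mulrC.
exact: yt.
Qed.

End Compactness.

Definition totally_bounded_unit_ball (R : realType) (K : fieldType)
    (w : valuation R K) :=
  forall e : R, 0 < e ->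
    exists s : seq K, forall x, w x <= 1 -> exists2 y, y \in s & w (x - y) < e.

(** * Finite extensions of a locally compact field *)

Section FiniteExtension.
Variables (R : realType) (F : fieldType) (v : na_valuation R F).
Variables (L : fieldExtType F) (w : na_valuation R L).
Hypothesis F_locally_compact : locally_compact [set: valued v].
Hypothesis F_nontrivial : nontrivial_valuation v.
Hypothesis L_extends : isometric v w (GRing.in_alg L).

Lemma ext_valuationZ a (x : L) : w (a *: x) = v a * w x.
Proof. by rewrite -mulr_algl valuationM L_extends. Qed.

Local Notation b := (vbasis {:L}).
Let B : R := 1 + \sum_(j < \dim {:L}) w b`_j.

Let B_gt0 : 0 < B.
Proof. by rewrite ltr_pwDl // sumr_ge0 // => j _; exact: valuation_ge0. Qed.

Let wbB (j : 'I_(\dim {:L})) : w b`_j <= B.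
Proof.
rewrite /B (bigD1 j) //= addrCA lerDl addr_ge0 // sumr_ge0 // => i _.
exact: valuation_ge0.
Qed.

Let comb_bound (c : 'I_(\dim {:L}) -> F) (e : R) : 0 <= e ->
  (forall j, v (c j) <= e) -> w (\sum_j c j *: b`_j) <= e * B.
Proof.
move=> e0 ce; apply: na_valuation_sum_le => [|j].
  by rewrite mulr_ge0 // ltW.
by rewrite ext_valuationZ ler_pM ?valuation_ge0.
Qed.

(** The value of a linear combination of the basis has a positive lower bound on
    the compact set of coordinate vectors [c] in [A] with [c j0 = t]. If [j0] is
    a coordinate of x of largest value then a scalar multiple of x lies in that
    set, and homogeneity yields the bound. *)
Lemma coord_bounded :
  exists2 C, 0 < C & forall x j, v (coord b j x) <= C * w x.
Proof.
have [A cA [d d0 dA]] := loc_compact_ball F_locally_compact.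
have [t t0 td] := nontrivial_small F_nontrivial d0.
have vt0 := valuation_gt0 v t0.
pose T : topologicalType := prod_topology (fun _ : 'I_(\dim {:L}) => valued v).
pose phi (c : T) := w (\sum_j (c j : F) *: b`_j).
pose S j0 : set T := [set c | forall j, (if j == j0 then [set t] else A) (c j)].
have cS j0 : compact (S j0).
  apply: (@tychonoff _ (fun=> valued v)
    (fun j => if j == j0 then [set t] else A)) => j; case: eqP => _ //.
  exact: compact_set1.
have S_gt0 j0 : exists2 m, 0 < m & forall c, S j0 c -> m <= phi c.
  apply: compact_lower_bound => // c Sc.
  have phic0 : 0 < phi c.
    apply: valuation_gt0; apply/eqP => c0.
    have := @coord_sum_free F L _ _ c j0 (basis_free (vbasisP {:L})).
    rewrite c0 linear0 => cj0; have := Sc j0; rewrite eqxx /= => tj0.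
    by rewrite -tj0 -cj0 eqxx in t0.
  (* By the isosceles principle [phi] is locally constant where it is not 0. *)
  exists (phi c) => //; pose e := phi c / (2 * B).
  have e0 : 0 < e by rewrite divr_gt0 // mulr_gt0.
  have : \forall c' \near c, forall j, v (c j - c' j) < e.
    apply: (@filter_forall T _ (fun j c' => v (c j - c' j) < e) (nbhs c)) => j.
    exact: (@proj_continuous _ (fun=> valued v) j c _
      (nbhsx_ballx (c j : valued v) e e0)).
  apply: filterS => c' cc'.
  suff cc : phi c = phi c' by rewrite cc.
  apply: na_valuation_eq.
  rewrite -sumrB; under eq_bigr do rewrite -scalerBl.
  apply: (@le_lt_trans _ _ (e * B)).
    by apply: comb_bound => [|j]; rewrite ltW.
  rewrite -[ltRHS]/(phi c) /e invfM mulrA mulfVK ?gt_eqF //.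
  by rewrite ltr_pdivrMr // mulr_natr mulr2n ltrDl.
have /choice[m mP] : forall j, exists m, 0 < m /\ forall c, S j c -> m <= phi c.
  by move=> j; have [m ? ?] := S_gt0 j; exists m.
pose C := \sum_j v t / m j.
have C0 : 0 <= C.
  rewrite sumr_ge0 // => j _; rewrite divr_ge0 ?valuation_ge0 //.
  by rewrite ltW //; case: (mP j).
exists (1 + C) => [|x j]; first by rewrite ltr_pwDl.
pose j0 := [arg max_(i > j) v (coord b i x)]%O.
have xj0 i : v (coord b i x) <= v (coord b j0 x).
  by rewrite /j0; case: arg_maxP => // k _; exact.
apply: le_trans (xj0 j) _.
have [x0|x0] := eqVneq (coord b j0 x) 0.
  by rewrite x0 valuation0 mulr_ge0 ?valuation_ge0 // addr_ge0.
have vx0 := valuation_gt0 v x0.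
have [m0 mS] := mP j0.
pose l := t / coord b j0 x.
have : m j0 <= w (l *: x).
  have -> : l *: x = \sum_j (l * coord b j x) *: b`_j.
    rewrite {1}(coord_vbasis (memvf x)) scaler_sumr.
    by apply: eq_bigr => i _; rewrite scalerA.
  apply: (mS (fun i => l * coord b i x)) => i; case: eqVneq => [->|_].
    by rewrite /= /l mulfVK.
  apply: dA; rewrite /l mulrAC valuationM valuationV.
  rewrite ltr_pdivrMr // valuationM.
  apply: (@le_lt_trans _ _ (v t * v (coord b j0 x))).
    by rewrite ler_wpM2l ?valuation_ge0.
  by rewrite ltr_pM2r.
rewrite ext_valuationZ /l valuationM valuationV mulrAC ler_pdivlMr //.
rewrite mulrC -ler_pdivlMr // => /le_trans; apply.
rewrite mulrAC; apply: ler_wpM2r; first exact: valuation_ge0.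
apply: (@le_trans _ _ C); last by rewrite lerDr.
rewrite /C (bigD1 j0) //= lerDl sumr_ge0 // => i _.
by rewrite divr_ge0 ?valuation_ge0 // ltW //; case: (mP i).
Qed.

(** A bound [w (g x) <= D * w x] applied to [x ^+ n] gives
    [(w (g x) / w x) ^+ n <= D] for all [n], hence [w (g x) <= w x]; the same
    for the inverse of x gives equality. *)
Lemma galois_isometric (g : {rmorphism L -> L}) :
  (forall a, g (GRing.in_alg L a) = GRing.in_alg L a) -> isometric w w g.
Proof.
move=> gF; have [C C0 coordC] := coord_bounded.
pose D := C * \sum_(j < \dim {:L}) w (g b`_j).
have gD x : w (g x) <= D * w x.
  have -> : g x = \sum_j coord b j x *: g b`_j.
    rewrite {1}(coord_vbasis (memvf x)) rmorph_sum; apply: eq_bigr => j _.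
    by rewrite -mulr_algl rmorphM gF mulr_algl.
  apply: na_valuation_sum_le => [|j].
    rewrite !mulr_ge0 ?valuation_ge0 ?(ltW C0) // sumr_ge0 // => j _.
    exact: valuation_ge0.
  rewrite ext_valuationZ /D mulrAC ler_pM ?valuation_ge0 //.
  rewrite (bigD1 j) //= lerDl sumr_ge0 // => i _.
  exact: valuation_ge0.
have g_le x : w (g x) <= w x.
  have [->|x0] := eqVneq x 0; first by rewrite rmorph0.
  have wx0 := valuation_gt0 w x0.
  rewrite -[leRHS]mul1r -ler_pdivrMr //.
  apply: (@le1_expr_bounded R _ D) => [|n].
    by rewrite divr_ge0 ?valuation_ge0.
  rewrite expr_div_n -!valuationX -rmorphXn ler_pdivrMr; first exact: gD.
  by rewrite valuationX exprn_gt0.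
move=> x; have [->|x0] := eqVneq x 0; first by rewrite rmorph0.
apply/eqP; rewrite eq_le g_le /=.
have := g_le x^-1; rewrite fmorphV !valuationV lef_pV2 //.
all: by rewrite posrE valuation_gt0 // fmorph_eq0.
Qed.

(** The coordinates of an integral element lie in a ball of radius [C] of F, so
    the combinations with coefficients in a finite net of that ball form a
    finite net. *)
Lemma ext_totally_bounded : totally_bounded_unit_ball w.
Proof.
move=> e e0; have [C C0 coordC] := coord_bounded.
pose e' := e / (2 * B).
have e'0 : 0 < e' by rewrite divr_gt0 // mulr_gt0.
have [s sP] := loc_compact_finite_net C F_locally_compact F_nontrivial e'0.
exists [seq \sum_j (s`_(f j)) *: b`_j
       | f : {ffun 'I_(\dim {:L}) -> 'I_(size s)}].
move=> x wx1.
have /choice[f fP] : forall j, exists k : 'I_(size s),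
    v (coord b j x - s`_k) < e'.
  move=> j; have [|y ys xy] := sP (coord b j x).
    by apply: le_trans (coordC x j) _; rewrite ger_pMr.
  have ks : (index y s < size s)%N by rewrite index_mem.
  by exists (Ordinal ks) => /=; rewrite nth_index.
exists (\sum_j (s`_(f j)) *: b`_j).
  apply/mapP; exists [ffun j => f j]; first by rewrite mem_enum.
  by apply: eq_bigr => j _; rewrite ffunE.
rewrite {1}(coord_vbasis (memvf x)) -sumrB; under eq_bigr do rewrite -scalerBl.
apply: (@le_lt_trans _ _ (e' * B)).
  by apply: comb_bound => [|j]; rewrite ltW.
rewrite /e' invfM mulrA mulfVK ?gt_eqF //.
by rewrite ltr_pdivrMr // mulr_natr mulr2n ltrDl.
Qed.

Lemma ext_nontrivial : nontrivial_valuation w.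
Proof.
have [a [va0 va1]] := F_nontrivial.
by exists (GRing.in_alg L a); rewrite L_extends.
Qed.

End FiniteExtension.

(** * The residue field and Teichmuller representatives *)

(** The number [q] is the order of [K]. Translation by 1 permutes [K], and
    comparing the sums over [K] gives [q = 0]; multiplication by a nonzero [x]
    permutes the nonzero elements, and comparing products gives
    [x ^+ q.-1 = 1]. *)
Lemma finite_field_card_exp (K : fieldType) (s : seq K) : (forall x, x \in s) ->
  exists2 q, (forall x : K, x ^+ q = x) & q%:R = 0 :> K.
Proof.
move=> sK; pose S := undup s.
have memS x : x \in S by rewrite mem_undup.
have uS : uniq S := undup_uniq s.
exists (size S).
  move=> x; have [->|x0] := eqVneq x 0.
    by case: (S) (memS 0) => // ? ? _; rewrite expr0n.
  pose T := rem 0 S.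
  have memT y : (y \in T) = (y != 0) by rewrite mem_rem_uniq // inE memS andbT.
  have uT : uniq T by rewrite rem_uniq.
  have permT : perm_eq [seq x * y | y <- T] T.
    apply: uniq_perm => //; first by rewrite map_inj_uniq //; exact: mulfI.
    move=> y; rewrite memT; apply/mapP/idP => [[z + ->]|y0].
      by rewrite memT; exact: mulf_neq0.
    by exists (x^-1 * y); rewrite ?mulVKf // memT mulf_neq0 ?invr_neq0.
  have prodT : \prod_(y <- T) y != 0.
    by rewrite prodf_seq_neq0; apply/allP => y; rewrite memT.
  have xT : x ^+ size T = 1.
    apply: (mulIf prodT); rewrite mul1r -[in RHS](perm_big _ permT) big_map.
    by rewrite big_split /= big_const_seq count_predT iter_mulr_1.
  have := perm_size (perm_to_rem (memS 0)); rewrite /= -/T => ->.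
  by rewrite exprS xT mulr1.
have permS1 : perm_eq [seq y + 1 | y <- S] S.
  apply: uniq_perm; rewrite ?(map_inj_uniq (addIr 1)) // => y.
  by rewrite memS; apply/mapP; exists (y - 1); rewrite ?memS ?subrK.
have : \sum_(y <- S) (y + 1) = \sum_(y <- S) y.
  by rewrite -[in RHS](perm_big _ permS1) big_map.
rewrite big_split /= -[RHS]addr0 => /addrI.
by rewrite big_const_seq count_predT iter_addr_0.
Qed.

Section TotallyBoundedUnitBall.
Variables (R : realType) (K : fieldType) (w : na_valuation R K).
Hypothesis K_totally_bounded : totally_bounded_unit_ball w.
Hypothesis K_nontrivial : nontrivial_valuation w.
Hypothesis K_complete : complete_valuation w.

Local Notation O := (valuation_ring w).
Local Notation k := (residue_field w).

Lemma residue_eq0 (a : O) : residue a = 0 <-> w (val a) < 1.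
Proof. by rewrite -(rmorph0 (@residue _ _ w)) residue_eq /= subr0. Qed.

Lemma residue_field_finite : exists s : seq k, forall q, q \in s.
Proof.
have [s sP] := K_totally_bounded ltr01.
exists [seq residue (insubd (0 : O) y) | y <- s] => q.
rewrite -[q]residue_reprK; set a := repr q.
have [y ys ay] := sP _ (vring_le1 a).
have yO : y \in valuation_ring_pred w.
  rewrite unfold_in /valuation_ring_pred -[y](subKr (val a)).
  by apply: le_trans (na_valuationB _ _ _) _; rewrite ge_max vring_le1 ltW.
apply/mapP; exists y => //; apply/residue_eq.
by rewrite val_insubd yO.
Qed.

Lemma residue_field_exp :
  exists2 q, (forall x : k, x ^+ q = x) & q%:R = 0 :> k.
Proof. by have [s] := residue_field_finite; exact: finite_field_card_exp. Qed.

(** Let [t] be nonzero with [w t < 1]. By the isosceles principle the values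
    above [w t] are already taken on a finite [w t]-net of the unit ball, so [r]
    can be the maximum of [w t] and of the values less than 1 on the net. *)
Lemma valuation_gap :
  exists2 r : R, 0 <= r < 1 & forall x, w x < 1 -> w x <= r.
Proof.
have [t t0 t1] := nontrivial_small K_nontrivial ltr01.
have [s sP] := K_totally_bounded (valuation_gt0 w t0).
pose r := \big[Order.max/w t]_(y <- s | w y < 1) w y.
exists r => [|x x1].
  apply/andP; split; last by apply: bigmax_lt.
  by apply: le_trans (valuation_ge0 w t) _; exact: bigmax_ge_id.
have [xt|tx] := leP (w x) (w t).
  by apply: le_trans xt _; exact: bigmax_ge_id.
have [y ys xy] := sP x (ltW x1).
have wxy : w x = w y by apply: na_valuation_eq; exact: lt_trans tx.
by rewrite wxy; apply: le_bigmax_seq => //; rewrite -wxy.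
Qed.

Section Contraction.
Variables (q : nat) (r : R).
Hypothesis q_exp : forall x : k, x ^+ q = x.
Hypothesis q_eq0 : q%:R = 0 :> k.
Hypothesis r01 : 0 <= r < 1.
Hypothesis r_gap : forall x, w x < 1 -> w x <= r.

Let r0 : 0 <= r. Proof. by case/andP: r01. Qed.

(** In [a ^+ q - c ^+ q = (a - c) * (a ^+ q.-1 + ... + c ^+ q.-1)] all [q] terms
    of the second factor have the same residue, so this factor has residue
    [q%:R * _ = 0] and value at most [r]. *)
Lemma exp_contraction (a c : O) : residue a = residue c ->
  w (val (a ^+ q) - val (c ^+ q)) <= r * w (val a - val c).
Proof.
move=> ac; rewrite -rmorphB subrXX rmorphM rmorphB valuationM mulrC.
rewrite ler_wpM2r ?valuation_ge0 //; apply/r_gap/residue_eq0.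
rewrite rmorph_sum /=; under eq_bigr => i _.
  rewrite rmorphM !rmorphXn /= ac -exprD subnK; last first.
    by rewrite -ltnS; case: (q) i => [[]|].
  over.
by rewrite sumr_const card_ord -mulr_natr q_eq0 mulr0.
Qed.

Lemma vring_mapX (h : {rmorphism K -> K}) (h_isom : isometric w w h)
  (a : O) n : vring_map h_isom (a ^+ n) = vring_map h_isom a ^+ n.
Proof.
apply: val_inj; transitivity (h (val a ^+ n)).
  by congr (h _); exact: rmorphXn.
by rewrite [RHS]rmorphXn [LHS]rmorphXn.
Qed.

Lemma fixed_residue_inj (a c : O) :
  a ^+ q = a -> c ^+ q = c -> residue a = residue c -> a = c.
Proof.
move=> aq cq ac; apply: val_inj; apply/eqP; rewrite -subr_eq0.
apply/eqP/(valuation_eq0 w)/eqP; rewrite eq_le valuation_ge0 andbT.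
have := exp_contraction ac; rewrite aq cq -subr_ge0 -{2}[w _]mul1r -mulrBl.
by rewrite nmulr_rge0 // subr_lt0; case/andP: r01.
Qed.

Lemma valuation_lim (u : nat -> K) :
    (forall n m, (n <= m)%N -> w (u n - u m) <= r ^+ n) ->
  exists t, forall e, 0 < e ->
    exists N, forall n, (N <= n)%N -> w (t - u n) < e.
Proof.
move=> u_cauchy; pose U : set_system (valued w) := (u : nat -> valued w) @ \oo.
have cU : cauchy U.
  apply: cauchy_exP => e e0; have [n rn] := exists_expr_lt r01 e0.
  exists (u n); exists n => // m /= nm.
  by apply: le_lt_trans (u_cauchy _ _ nm) rn.
have [t ut] : exists t : valued w, U --> t by apply/cvg_ex; exact: K_complete.
exists t => e e0; have [N _ NP] := ut _ (nbhsx_ballx t e e0).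
by exists N.
Qed.

(** The representative is the limit of the powers [a ^+ (q ^ n)]: they stay in
    the residue class of [a], and by the contraction they form a Cauchy
    sequence. *)
Lemma teichmuller_exists (a : O) :
  exists2 t : O, t ^+ q = t & residue t = residue a.
Proof.
pose u n : O := a ^+ (q ^ n).
have uS n : u n.+1 = u n ^+ q by rewrite /u expnSr exprM.
have res_u n : residue (u n) = residue a.
  elim: n => [|n IHn]; first by rewrite /u expn0 expr1.
  by rewrite uS rmorphXn /= IHn q_exp.
have u_step n : w (val (u n) - val (u n.+1)) <= r ^+ n.
  elim: n => [|n IHn].
    apply: le_trans (na_valuationB _ _ _) _.
    by rewrite expr0 ge_max !vring_le1.
  rewrite [u n.+2]uS {1}[u n.+1]uS exprS.
  apply: le_trans (exp_contraction _) _; first by rewrite !res_u.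
  by rewrite ler_wpM2l.
have u_cauchy n m : (n <= m)%N -> w (val (u n) - val (u m)) <= r ^+ n.
  move=> /subnKC <-; elim: (m - n)%N => [|d IHd].
    by rewrite addn0 subrr valuation0 exprn_ge0.
  rewrite -(subrKA (val (u (n + d)%N))).
  apply: le_trans (na_valuationD _ _ _) _; rewrite ge_max IHd addnS /=.
  apply: le_trans (u_step _) _; apply: ler_wiXn2l; rewrite ?leq_addr //.
  by case/andP: r01 => _ /ltW.
have [t tu] := valuation_lim u_cauchy.
have [N tuN] := tu 1 ltr01.
have tO : t \in valuation_ring_pred w.
  rewrite unfold_in /valuation_ring_pred -(subrK (val (u N)) t).
  apply: le_trans (na_valuationD _ _ _) _.
  by rewrite ge_max vring_le1 ltW // tuN.
pose t' : O := ValuationRing tO.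
have res_t : residue t' = residue a.
  by rewrite -(res_u N); apply/residue_eq; exact: tuN.
exists t' => //; apply: val_inj; apply/eqP; rewrite -subr_eq0.
apply/eqP/(valuation_eq0 w)/eqP; rewrite eq_le valuation_ge0 andbT.
rewrite leNgt; apply/negP => /tu[M tuM].
(* Both [t' ^+ q] and [t'] are closer to the term [u M.+1 = u M ^+ q] than their
   supposed positive distance. *)
have : w (val (t' ^+ q) - val t') < w (val (t' ^+ q) - val t').
  rewrite -{1}(subrKA (val (u M.+1))).
  apply: le_lt_trans (na_valuationD _ _ _) _; rewrite gt_max.
  rewrite [X in _ && (X < _)]valuationB tuM // andbT uS.
  apply: le_lt_trans (exp_contraction _) _; first by rewrite res_u.
  apply: le_lt_trans (tuM _ (leqnn _)); rewrite ler_piMl ?valuation_ge0 //.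
  by case/andP: r01 => _ /ltW.
by rewrite ltxx.
Qed.

(** Put [d x = h x - x]. If [d] is bounded by [r ^+ n] on the valuation ring
    then it is bounded by [r ^+ n.+1] on the maximal ideal, whose elements are
    products of an element fixed by [h], of value at most [r], and an integral
    element, and also on [a ^+ q], by the contraction. As [a ^+ q - a] lies in
    the maximal ideal, the better bound holds at every [a]. *)
Lemma inertia_trivial (h : {rmorphism K -> K}) (h_isom : isometric w w h)
    (h_scal : forall x, x != 0 -> exists a, h a = a /\ w a = w x) :
  (forall a : O, residue (vring_map h_isom a) = residue a) -> h =1 id.
Proof.
move=> h_res.
have hO n (a : O) : w (h (val a) - val a) <= r ^+ n.
  elim: n a => [|n IHn] a.
    apply: le_trans (na_valuationB _ _ _) _.
    by rewrite ge_max h_isom expr0 vring_le1.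
  have hM (c : O) : w (val c) < 1 -> w (h (val c) - val c) <= r ^+ n.+1.
    move=> c1; have [->|c0] := eqVneq (val c) 0.
      by rewrite rmorph0 subrr valuation0 exprn_ge0.
    have [z [hz wz]] := h_scal _ c0.
    have wz0 : 0 < w z by rewrite wz valuation_gt0.
    have z0 : z != 0 by apply: contraTneq wz0 => ->; rewrite valuation0 ltxx.
    have yO : val c / z \in valuation_ring_pred w.
      rewrite unfold_in /valuation_ring_pred valuationM valuationV -wz.
      by rewrite divff ?gt_eqF.
    have -> : val c = z * (val c / z) by rewrite mulrC mulfVK.
    rewrite rmorphM hz -mulrBr valuationM exprS ler_pM ?valuation_ge0 //.
      by rewrite wz; exact: r_gap.
    exact: (IHn (ValuationRing yO)).
  have -> : h (val a) - val a = (h (val (a ^+ q)) - val (a ^+ q)) -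
      (h (val (a ^+ q - a)) - val (a ^+ q - a)).
    rewrite !rmorphB /=.
    rewrite [X in _ = _ - X](_ : _ = (h (val (a ^+ q)) - val (a ^+ q)) -
      (h (val a) - val a)) ?subKr //.
    by rewrite [- (val _ - _)]opprD addrACA -opprD.
  apply: le_trans (na_valuationB _ _ _) _; rewrite ge_max; apply/andP; split.
    rewrite -[h _]/(val (vring_map h_isom (a ^+ q))) vring_mapX.
    apply: le_trans (exp_contraction (h_res a)) _; rewrite exprS.
    by apply: ler_wpM2l => //; exact: IHn.
  by apply: hM; apply/residue_eq0; rewrite rmorphB rmorphXn /= q_exp subrr.
have hO_id (a : O) : h (val a) = val a.
  apply/eqP; rewrite -subr_eq0; apply/eqP/(valuation_eq0 w)/eqP.
  rewrite eq_le valuation_ge0 andbT leNgt; apply/negP.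
  by move=> /(exists_expr_lt r01)[n]; rewrite ltNge hO.
move=> x; have [x1|/ltW x1] := leP (w x) 1.
  exact: (hO_id (ValuationRing (x1 : x \in valuation_ring_pred w))).
have [x0|x0] := eqVneq x 0; first by rewrite x0 rmorph0.
have xO : x^-1 \in valuation_ring_pred w.
  by rewrite unfold_in /valuation_ring_pred valuationV invf_le1 ?valuation_gt0.
have := hO_id (ValuationRing xO); rewrite /= fmorphV.
by move/invr_inj.
Qed.

End Contraction.

(** An isometric automorphism [h] maps the Teichmuller representative of [x] to
    a solution of [t ^+ q = t] in the residue class of the image of [x], and
    such a solution is unique. *)
Lemma equivariant_section : exists s : k -> O,
  (forall x, residue (s x) = x) /\
  forall (h : {rmorphism K -> K}) (h_isom : isometric w w h) x,
    s (residue_map h_isom x) = vring_map h_isom (s x).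
Proof.
have [q q_exp q_eq0] := residue_field_exp.
have [r r01 r_gap] := valuation_gap.
have /choice[s sP] : forall x : k, exists t : O, t ^+ q = t /\ residue t = x.
  move=> x.
  have [t tq res_t] := teichmuller_exists q_exp q_eq0 r01 r_gap (repr x).
  by exists t; rewrite res_t residue_reprK.
exists s; split=> [x|h h_isom x]; first by case: (sP x).
have [sxq res_sx] := sP x.
have [shq res_sh] := sP (residue_map h_isom x).
apply: (fixed_residue_inj q_eq0 r01 r_gap) => //.
  by rewrite -vring_mapX sxq.
by rewrite res_sh -residue_mapE res_sx.
Qed.

(** The first premise says that the fixed field of [h] has the same value group
    as [K]. *)
Lemma unramified_inertia_trivial (h : {rmorphism K -> K})
    (h_isom : isometric w w h) :
    (forall x, x != 0 -> exists a, h a = a /\ w a = w x) ->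
  residue_map h_isom =1 id -> h =1 id.
Proof.
move=> h_scal h_res.
have [q q_exp q_eq0] := residue_field_exp.
have [r r01 r_gap] := valuation_gap.
apply: (inertia_trivial q_exp q_eq0 r01 r_gap (h_isom := h_isom)) => // a.
by rewrite -residue_mapE h_res.
Qed.

End TotallyBoundedUnitBall.

(** * Reduction of functions to the residue field *)

Lemma trivial_valuation_lt1 (R : realType) (K : fieldType) (x : K) :
  trivial_valuation R K x < 1 -> x = 0.
Proof. by rewrite /= /trivial_fun; case: eqP => //; rewrite ltxx. Qed.

Lemma trivial_valuation_complete (R : realType) (K : fieldType) :
  complete_valuation (trivial_valuation R K).
Proof.
move=> G PG /cauchyP cG; have [x Gx] := cG 1 ltr01.
apply/cvg_ex; exists x => U /nbhs_singleton Ux.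
apply: filterS Gx => y /trivial_valuation_lt1/eqP; rewrite subr_eq0 => /eqP <-.
exact: Ux.
Qed.

Section ResidueIsomorphism.
Variables (R : realType) (L : fieldType) (w : na_valuation R L).
Variables (X : ptopologicalType) (tau : X -> X) (g : {rmorphism L -> L}).
Variable g_isom : isometric w w g.
Hypothesis X_compact : compact [set: X].
Local Notation C := (fun_alg w tau g).
Local Notation O := (unit_ball w tau g).
Local Notation k := (residue_field w).
Local Notation wbar := (trivial_valuation R k).
Local Notation gbar := (residue_map g_isom).

Lemma fun_algP (K : fieldType) (u : valuation R K) (h : {rmorphism K -> K})
    (f : X -> valued u) :
  f \in fun_alg_pred tau h <->
  (forall x (e : R), 0 < e -> \forall y \near x, u (f x - f y) < e) /\
  forall x, f (tau x) = h (f x).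
Proof.
rewrite unfold_in; split=> [/asboolP[/continuous_valuedP]|[? ?]] //.
by apply/asboolP; split=> //; apply/continuous_valuedP.
Qed.

Lemma unit_ballP (f : C) :
  f \in @unit_ball_pred _ _ w _ tau g <->
  forall x, f x \in valuation_ring_pred w.
Proof.
split=> [f1 x|f1]; rewrite unfold_in.
  rewrite /valuation_ring_pred -lee_fin; apply: le_trans f1.
  by apply: ereal_sup_ubound; exists x.
by apply: ge_ereal_sup => _ [x _ <-]; rewrite lee_fin; exact: f1.
Qed.

Definition unit_ball_eval (f : O) (x : X) : valuation_ring w :=
  ValuationRing ((unit_ballP _).1 (unit_ball_valP f) x).

(** Compactness of X turns the pointwise strict inequality into one for the
    supremum: [1 - w (f x)] is bounded away from 0. *)
Lemma open_unit_ballP (f : O) :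
  f \in @open_unit_ball _ _ w _ tau g <->
  forall x, residue (unit_ball_eval f x) = 0.
Proof.
split=> [f1 x|f1].
  apply/residue_eq0; rewrite /= -lte_fin; apply: le_lt_trans f1.
  by apply: ereal_sup_ubound; exists x.
have /fun_algP[cf _] := fun_alg_valP (val f).
pose phi x := 1 - w (val f x).
have [|d d0 fd] := compact_lower_bound (phi := phi) X_compact.
  move=> x _; have := f1 x; move/residue_eq0 => /= fx1.
  exists (1 - Num.max (w (val f x)) (1 / 2)).
    by rewrite subr_gt0 gt_max fx1 /= ltr_pdivrMr // mul1r ltr1n.
  have : \forall y \near x, w (val f x - val f y) < 1 / 2.
    by apply: cf; rewrite divr_gt0.
  apply: filterS => y xy; rewrite lerD2l lerN2.
  have := na_valuationB w (val f x) (val f x - val f y).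
  rewrite subKr => /le_trans; apply.
  by rewrite ge_max !le_max lexx /= (ltW xy) orbT.
rewrite unfold_in /open_unit_ball; apply: (@le_lt_trans _ _ (1 - d)%:E).
  apply: ge_ereal_sup => _ [x _ <-]; rewrite lee_fin.
  by rewrite lerBrDr -lerBrDl; exact: fd.
by rewrite lte_fin ltrBlDr ltrDl.
Qed.

Lemma residue_fun_subproof (f : O) :
  (fun x => residue (unit_ball_eval f x) : valued wbar)
    \in fun_alg_pred tau gbar.
Proof.
have /fun_algP[cf gf] := fun_alg_valP (val f).
apply/fun_algP; split=> [x e e0|x].
  apply: filterS (cf x 1 ltr01) => y xy.
  have -> : residue (unit_ball_eval f x) = residue (unit_ball_eval f y).
    exact/residue_eq.
  by rewrite subrr valuation0.
by rewrite [RHS]residue_mapE; congr residue; apply: val_inj; exact: gf.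
Qed.

Definition residue_fun (f : O) : fun_alg wbar tau gbar :=
  FunAlg (residue_fun_subproof f).

Lemma residue_fun_is_zmod : zmod_morphism residue_fun.
Proof.
move=> f h; apply: val_inj; apply/funext => x.
have fhx : unit_ball_eval (f - h) x = unit_ball_eval f x - unit_ball_eval h x.
  by apply: val_inj; rewrite rmorphB.
have : residue (unit_ball_eval (f - h) x) =
    residue (unit_ball_eval f x) - residue (unit_ball_eval h x).
  by rewrite fhx rmorphB.
exact.
Qed.

Lemma residue_fun_is_monoid : monoid_morphism residue_fun.
Proof.
split=> [|f h]; apply: val_inj; apply/funext => x.
  have : residue (unit_ball_eval 1 x) = 1.
    by rewrite -(rmorph1 (@residue _ _ w)); congr residue; apply: val_inj.
  exact.
have fhx : unit_ball_eval (f * h) x = unit_ball_eval f x * unit_ball_eval h x.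
  by apply: val_inj; rewrite rmorphM.
have : residue (unit_ball_eval (f * h) x) =
    residue (unit_ball_eval f x) * residue (unit_ball_eval h x).
  by rewrite fhx rmorphM.
exact.
Qed.

HB.instance Definition _ :=
  GRing.isZmodMorphism.Build O (fun_alg wbar tau gbar) residue_fun
    residue_fun_is_zmod.
HB.instance Definition _ :=
  GRing.isMonoidMorphism.Build O (fun_alg wbar tau gbar) residue_fun
    residue_fun_is_monoid.

Lemma residue_fun_eq0 (f : O) :
  residue_fun f = 0 <-> f \in @open_unit_ball _ _ w _ tau g.
Proof.
rewrite open_unit_ballP; split=> [f0 x|f0].
  by have := congr1 (fun h : fun_alg wbar tau gbar => h x) f0.
by apply: val_inj; apply/funext => x; exact: f0.
Qed.

Local Notation A := (residue_algebra w tau g).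
Local Notation cls := (\pi_({ideal_quot (@open_unit_ball _ _ w _ tau g)})%qT).

Lemma cls_eq (f h : O) : cls f = cls h <-> residue_fun f = residue_fun h.
Proof.
have -> : residue_fun f = residue_fun h <-> residue_fun (f - h) = 0.
  by rewrite rmorphB /=; split=> [->|/eqP]; rewrite ?subrr // subr_eq0 => /eqP.
rewrite residue_fun_eq0 Quotient.idealrBE.
by split=> [/eqP|] // /eqP.
Qed.

Definition quotient_residue_fun (q : A) : fun_alg wbar tau gbar :=
  residue_fun (repr q).

Lemma quotient_residue_funE f : quotient_residue_fun (cls f) = residue_fun f.
Proof. by apply/cls_eq; rewrite reprK. Qed.

Lemma quotient_residue_fun_is_zmod : zmod_morphism quotient_residue_fun.
Proof.
move=> p q; rewrite -[p]reprK -[q]reprK -rmorphB !quotient_residue_funE.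
exact: rmorphB.
Qed.

Lemma quotient_residue_fun_is_monoid : monoid_morphism quotient_residue_fun.
Proof.
split=> [|p q].
  by rewrite -(rmorph1 cls) quotient_residue_funE rmorph1.
rewrite -[p]reprK -[q]reprK -rmorphM !quotient_residue_funE.
exact: rmorphM.
Qed.

HB.instance Definition _ :=
  GRing.isZmodMorphism.Build A (fun_alg wbar tau gbar) quotient_residue_fun
    quotient_residue_fun_is_zmod.
HB.instance Definition _ :=
  GRing.isMonoidMorphism.Build A (fun_alg wbar tau gbar) quotient_residue_fun
    quotient_residue_fun_is_monoid.

Definition quotient_residue_morphism : {rmorphism A -> fun_alg wbar tau gbar} :=
  quotient_residue_fun.

Lemma quotient_residue_fun_inj : injective quotient_residue_fun.
Proof. by move=> p q /cls_eq; rewrite !reprK. Qed.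

(** The lift [s \o F] is locally constant because [F] is, and it is equivariant
    because [s] is. *)
Lemma residue_fun_surj (s : k -> valuation_ring w) (F : fun_alg wbar tau gbar) :
    (forall x, residue (s x) = x) ->
    (forall x, s (gbar x) = vring_map g_isom (s x)) ->
  exists f, residue_fun f = F.
Proof.
move=> sK sg; have /fun_algP[cF gF] := fun_alg_valP F.
have fP : (fun x => val (s (F x)) : valued w) \in fun_alg_pred tau g.
  apply/fun_algP; split=> [x e e0|x]; last by rewrite gF sg.
  apply: filterS (cF x 1 ltr01) => y /trivial_valuation_lt1/eqP.
  by rewrite subr_eq0 => /eqP ->; rewrite subrr valuation0.
have fO : FunAlg fP \in @unit_ball_pred _ _ w _ tau g.
  by apply/unit_ballP => x; exact: vring_valP.
exists (UnitBall fO); apply: val_inj; apply/funext => x.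
rewrite [LHS]/(residue _) -[RHS]sK; congr residue.
exact: val_inj.
Qed.

Lemma sup_norm_ge (K : fieldType) (u : valuation R K) (h : {rmorphism K -> K})
  (f : fun_alg u tau h) x : ((u (f x))%:E <= sup_norm f)%E.
Proof. by apply: ereal_sup_ubound; exists x. Qed.

(** Outside the ideal every representative has norm exactly 1, since it stays in
    the closed unit ball and cannot enter the open one. *)
Lemma quotient_residue_fun_norm q :
  sup_norm (quotient_residue_fun q) = quotient_norm q.
Proof.
rewrite /quotient_residue_fun /quotient_norm; set f := repr q.
have [f0|f0] := eqVneq (residue_fun f) 0.
  have fJ := (residue_fun_eq0 f).1 f0.
  rewrite f0; transitivity (0%:E : \bar R); apply/eqP; rewrite eq_le;
    apply/andP; split.
  - by apply: ge_ereal_sup => _ [x _ <-]; rewrite [X in X%:E]valuation0.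
  - by apply: le_trans (sup_norm_ge _ point); rewrite lee_fin valuation_ge0.
  - apply: le_ereal_inf_tmp => _ [h _ <-].
    by apply: le_trans (sup_norm_ge _ point); rewrite lee_fin valuation_ge0.
  - apply: ereal_inf_lbound; exists (- f); first by rewrite /= rpredN.
    by rewrite subrr rmorph0 sup_norm0.
have normJ h : h \in @open_unit_ball _ _ w _ tau g ->
    sup_norm (val (f + h)) = 1%E.
  move=> hJ; apply/eqP; rewrite eq_le; apply/andP; split.
    exact: unit_ball_valP.
  rewrite leNgt; apply: contra f0 => fhJ; apply/eqP/residue_fun_eq0.
  by rewrite -(addrK h f) rpredB.
transitivity (1%:E : \bar R); last first.
  rewrite (_ : image _ _ = [set 1%E]) ?ereal_inf1 //.
  apply/seteqP; split=> [_ [h hJ <-]|_ ->]; first exact: normJ.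
  by exists 0; rewrite ?normJ //= rpred0.
have [x fx] : exists x, residue_fun f x <> 0.
  apply/existsNP => f0'; move/eqP: f0; apply; apply: val_inj; exact/funext.
apply/eqP; rewrite eq_le; apply/andP; split.
  apply: ge_ereal_sup => _ [y _ <-]; rewrite lee_fin.
  by rewrite [leLHS]/((_ != 0)%:R) lern1 leq_b1.
apply: le_trans (sup_norm_ge _ x); rewrite lee_fin.
rewrite [leRHS]/((_ != 0)%:R).
by move/eqP: fx => ->.
Qed.

End ResidueIsomorphism.

(** * Orders of automorphisms and the theorem *)

Lemma inj_surj_bijective (A B : Type) (f : A -> B) :
  injective f -> (forall b, exists a, f a = b) -> bijective f.
Proof.
move=> f_inj /choice[f' f'K]; exists f' => //.
exact: inj_can_sym f'K f_inj.
Qed.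

(** Infinite orders are covered as well: both sides are then 0. *)
Lemma eq_ord (T T' : Type) (h : T -> T) (h' : T' -> T') :
  (forall m, iter m h = id <-> iter m h' = id) -> ord h = ord h'.
Proof.
move=> hh'; rewrite /ord; congr (xget 0%N); apply/seteqP.
by split=> n [n0 /hh' hn min_n]; split=> // m m0 /hh'; exact: min_n.
Qed.

Lemma iter_rmorphism (K : fieldType) (g : {rmorphism K -> K}) m :
  exists h : {rmorphism K -> K}, h =1 iter m g.
Proof.
elim: m => [|m [h hE]]; first by exists idfun.
by exists (g \o h) => x /=; rewrite hE.
Qed.

Section ResidueAutomorphism.
Variables (R : realType) (L : fieldType) (w : na_valuation R L).
Variables (g : {rmorphism L -> L}) (g_isom : isometric w w g).
Local Notation gbar := (residue_map g_isom).

Lemma iter_residue_map m (a : valuation_ring w) :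
  exists2 c : valuation_ring w,
    val c = iter m g (val a) & iter m gbar (residue a) = residue c.
Proof.
elim: m => [|m [c ca IHc]]; first by exists a.
by exists (vring_map g_isom c); rewrite /= ?ca // IHc residue_mapE.
Qed.

Lemma iter_residue_map_id m : iter m g = id -> iter m gbar = id.
Proof.
move=> gm; apply/funext => x; rewrite -[x in LHS]residue_reprK.
have [c ca ->] := iter_residue_map m (repr x).
by rewrite -[RHS]residue_reprK; congr residue; apply: val_inj; rewrite ca gm.
Qed.

Lemma residue_map_bijective : bijective g -> bijective gbar.
Proof.
move=> [g' g'K gK]; apply: inj_surj_bijective; first exact: fmorph_inj.
move=> x; pose a : valuation_ring w := repr x.
have bO : g' (val a) \in valuation_ring_pred w.
  by rewrite unfold_in /valuation_ring_pred -g_isom gK vring_le1.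
exists (residue (ValuationRing bO)); rewrite residue_mapE -[RHS]residue_reprK.
by congr residue; apply: val_inj; rewrite /= gK.
Qed.

End ResidueAutomorphism.

Theorem theorem5p4p5 (R : realType)
    (F : fieldType) (v : na_valuation R F)
    (L : fieldExtType F) (w : na_valuation R L)
    (X : ptopologicalType) (tau : X -> X) (g : {rmorphism L -> L})
    (F_char0 : [pchar F] =i pred0)
    (F_complete : complete_valuation v)
    (F_locally_compact : locally_compact [set: valued v])
    (F_nontrivial : nontrivial_valuation v)
    (L_extends : isometric v w (GRing.in_alg L))
    (g_gal : in_Gal (GRing.in_alg L) g)
    (C_basic : basic_function_algebra_over v w (GRing.in_alg L) tau g) :
  exists g_isom : isometric w w g,
    let vbar := trivial_valuation R (residue_field v) in
    let wbar := trivial_valuation R (residue_field w) in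
    let ibar : {rmorphism residue_field v -> residue_field w} :=
      residue_map L_extends in
    let gbar : {rmorphism residue_field w -> residue_field w} :=
      residue_map g_isom in
    (unramified v w ->
       basic_function_algebra_over vbar wbar ibar tau gbar /\
       isometrically_isomorphic
         (residue_algebra w tau g) (fun_alg wbar tau gbar)
         quotient_norm sup_norm) /\
    ((ord tau %| ord gbar)%N ->
       basic_function_algebra_over vbar wbar ibar tau gbar /\
       isometrically_isomorphic
         (residue_algebra w tau g) (fun_alg wbar tau gbar)
         quotient_norm sup_norm).
Proof.
have [g_bij gF] := g_gal.
have [[_ w_complete _ _ X_compact X_hausdorff X_disconnected _ tau_cont
  tau_order tau_ord] g_fixed] := C_basic.
have g_isom := galois_isometric F_locally_compact F_nontrivial L_extends gF.
have L_net := ext_totally_bounded F_locally_compact F_nontrivial L_extends.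
have w_nontrivial := ext_nontrivial F_nontrivial L_extends.
have [s [sK sg]] := equivariant_section L_net w_nontrivial w_complete.
exists g_isom => vbar wbar ibar gbar.
have main : (ord tau %| ord gbar)%N ->
    basic_function_algebra_over vbar wbar ibar tau gbar /\
    isometrically_isomorphic
      (residue_algebra w tau g) (fun_alg wbar tau gbar) quotient_norm sup_norm.
  move=> ord_gbar; split; last first.
    exists (quotient_residue_morphism tau g_isom X_compact); split; last first.
      exact: quotient_residue_fun_norm.
    apply: inj_surj_bijective; first exact: quotient_residue_fun_inj.
    move=> f; have [h hf] := residue_fun_surj f sK (sg g g_isom).
    exists (\pi_({ideal_quot (@open_unit_ball _ _ w _ tau g)})%qT h).
    by rewrite -hf -(quotient_residue_funE g_isom X_compact).
  have ibarE a : ibar (residue a) = residue (vring_map L_extends a).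
    exact: residue_mapE.
  have gbarE a : gbar (residue a) = residue (vring_map g_isom a).
    exact: residue_mapE.
  have gbar_ibar x : gbar (ibar x) = ibar x.
    rewrite -[x]residue_reprK ibarE gbarE; congr residue; apply: val_inj.
    exact: gF.
  split.
    split=> //.
    - exact: trivial_valuation_complete.
    - exact: trivial_valuation_complete.
    - have [t tP] := residue_field_finite L_net.
      exists (size t), (fun j => t`_j) => x.
      have xt : (index x t < size t)%N by rewrite index_mem.
      (* All residues together span, so [x] has a coordinate vector. *)
      exists (fun j => (j == Ordinal xt)%:R).
      rewrite (bigD1 (Ordinal xt)) //= eqxx rmorph1 mul1r nth_index //.
      rewrite big1 ?addr0 // => j /negPf ->.
      by rewrite rmorph0 mul0r.
    - by move=> x; rewrite /= /trivial_fun fmorph_eq0.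
    - by move=> _; apply: X_disconnected; exact: na_valuationB.
    - by split; [exact: residue_map_bijective|].
  (* The Teichmuller representative of a residue fixed by [gbar] is fixed by
     [g], hence lies in F. *)
  apply/seteqP; split=> [x gx|_ [x _ <-]]; last exact: gbar_ibar.
  have : fixed_field g (val (s x)).
    have gsx : vring_map g_isom (s x) = s x by rewrite -sg; congr s; exact: gx.
    exact: (congr1 val gsx).
  rewrite g_fixed => -[a _ ax].
  have aO : a \in valuation_ring_pred v.
    by rewrite unfold_in /valuation_ring_pred -L_extends ax vring_le1.
  exists (residue (ValuationRing aO)) => //; rewrite ibarE -[RHS]sK.
  by congr residue; exact: val_inj.
split=> // vw_unram; apply: main; suff <- : ord g = ord gbar by [].
apply: eq_ord => m; split; first exact: iter_residue_map_id.
move=> gbarm; have [h hE] := iter_rmorphism g m.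
suff h_id : h =1 id by apply/funext => x; rewrite -hE.
have h_isom : isometric w w h.
  by move=> x; rewrite hE; elim: m {gbarm hE} => //= m IHm; rewrite g_isom.
apply: (unramified_inertia_trivial L_net w_nontrivial (h_isom := h_isom)).
  move=> x x0; have : (v @` [set a | a != 0]) (w x).
    by rewrite -vw_unram; exists x.
  move=> [a _ va]; exists (GRing.in_alg L a); rewrite L_extends; split=> //.
  by rewrite hE; elim: m {gbarm hE} => //= m ->; exact: gF.
move=> x; rewrite -[x in LHS]residue_reprK residue_mapE.
have [c ca] := iter_residue_map g_isom m (repr x).
rewrite gbarm /= residue_reprK => xc; rewrite [RHS]xc; congr residue.
by apply: val_inj; rewrite ca /= hE.
Qed.
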